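(* (i) Each d.c. domain in $\mathbb{R}^d$ is a locally WDC set. (ii) Every $k$-dimensional d.c. surface in $\mathbb{R}^d$ is a locally WDC set.
   Context: A real function on $\mathbb{R}^d$ (or on a linear space) is d.c. if it is a difference of two convex functions (hence locally Lipschitz); a mapping into a finite-dimensional space is a d.c. mapping if each of its components is d.c. A d.c. domain in $\mathbb{R}^d$ is a set which can be locally represented as the subgraph of a d.c. function: for every point $x$ of the set $M$ there are an open neighbourhood $U_x$, a $(d-1)$-dimensional linear subspace $E$, a unit vector $e\perp E$ and a d.c. function $f:E\to\mathbb{R}$ with $M\cap U_x=\{u+se:u\in E,\ s\le f(u)\}\cap U_x$. A set $M\subset\mathbb{R}^d$ is a $k$-dimensional d.c. surface if for every $x\in M$ there are an open neighbourhood $U_x$ of $x$, a $k$-dimensional linear subspace $L_x$ of $\mathbb{R}^d$ and a d.c. mapping $\phi_x:L_x\to L_x^\perp$ such that $M\cap U_x=\{u+\phi_x(u):u\in L_x\}\cap U_x$. For a locally Lipschitz $f$, the Clarke subdifferential $\partial^*f(x)$ is the closed convex hull of the set of accumulation points of gradients $\nabla f(x_i)$ at differentiability points $x_i\to x$. A compact $A\subset\mathbb{R}^d$ is WDC if $A=f^{-1}((-\infty,c])$ for some d.c. $f:\mathbb{R}^d\to\mathbb{R}$ and $c\in\mathbb{R}$ for which there is $\varepsilon>0$ with $|v|\ge\varepsilon$ whenever $c<f(x)<c+\varepsilon$ and $v\in\partial^*f(x)$. A set $A\subset\mathbb{R}^d$ is locally WDC if for every $x\in A$ there are an open neighbourhood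 $U_x$ of $x$ and a WDC set $A_x$ with $A\cap U_x=A_x\cap U_x$. *)

(* Defs.v *)
From HB Require Import structures.
From mathcomp Require Import all_boot all_order all_algebra.
From mathcomp Require Import all_classical all_reals all_analysis.

Set Implicit Arguments.
Unset Strict Implicit.
Unset Printing Implicit Defensive.

Import Order.TTheory GRing.Theory Num.Theory.
Import numFieldNormedType.Exports.

Local Open Scope classical_set_scope.
Local Open Scope ring_scope.

(* R^d is 'rV[R]_d; the library equips it with the sup norm, which is only
   used through its topology. The Euclidean structure is defined here. *)
Definition dotv (R : realType) (d : nat) (u v : 'rV[R]_d) : R :=
  \sum_(i < d) u 0 i * v 0 i.

Section dotv_theory.
Variables (R : realType) (d : nat).
Implicit Types (u v w : 'rV[R]_d) (a : R).

Fact dotvC u v : dotv u v = dotv v u.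
Proof. by apply: eq_bigr => i _; rewrite mulrC. Qed.

Fact dotv_linearl v : linear_for *%R ((@dotv R d)^~ v).
Proof.
move=> a u w; rewrite /dotv mulr_sumr -big_split; apply: eq_bigr => i _ /=.
by rewrite !mxE mulrDl mulrA.
Qed.

Fact dotv_bilinear :
  bilinear_for (GRing.Scale.Law.clone _ _ *%R _)
    (GRing.Scale.Law.clone _ _ (idfun \; *%R) _) (@dotv R d).
Proof.
split=> [v|u a v w]; first exact: dotv_linearl.
by rewrite dotvC dotv_linearl ![dotv _ u]dotvC.
Qed.

Fact dotv_hermitian u v : dotv u v = (-1) ^+ false * idfun (dotv v u).
Proof. by rewrite expr0 mul1r dotvC. Qed.

Fact dotv_gt0 u : u != 0 -> 0 < dotv u u.
Proof.
move=> u0; rewrite lt_neqAle sumr_ge0 ?andbT => [|i _]; last exact: sqr_ge0.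
apply: contraNneq u0 => /esym/eqP.
rewrite psumr_eq0 => [|i _]; last exact: sqr_ge0.
move=> /allP u0; apply/eqP/rowP => i; rewrite mxE; apply/eqP.
by have /= := u0 i (mem_index_enum _); rewrite mulf_eq0 orbb.
Qed.

HB.instance Definition _ := bilinear_isBilinear.Build R _ _ _
  (GRing.Scale.Law.clone _ _ *%R _)
  (GRing.Scale.Law.clone _ _ (idfun \; *%R) _) (@dotv R d) dotv_bilinear.
HB.instance Definition _ := isHermitianSesquilinear.Build R _ false idfun
  (@dotv R d) dotv_hermitian.
HB.instance Definition _ := isDotProduct.Build R _ (@dotv R d) dotv_gt0.

End dotv_theory.

Definition enorm (R : realType) (d : nat) (v : 'rV[R]_d) : R :=
  Num.sqrt (dotv v v).

Definition orthc (R : realType) (d : nat) (L : {vspace 'rV[R]_d}) :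
  {vspace 'rV[R]_d} := orthov (@dotv R d) L.

Definition dc_function (R : realType) (V : lmodType R) (f : V -> R) : Prop :=
  exists g h : V -> R,
    [/\ convex_function setT g, convex_function setT h &
        forall x, f x = g x - h x].

(* Components are taken in a basis of W. As linear combinations of d.c.
   functions are d.c., the choice of the basis is immaterial. *)
Definition dc_mapping (R : realType) (V : lmodType R) (W : vectType R)
    (phi : V -> W) : Prop :=
  forall i, dc_function (fun x => coord (vbasis {:W}) i (phi x)).

Definition gradient (R : realType) (d : nat) (f : 'rV[R]_d -> R)
    (x : 'rV[R]_d) : 'rV[R]_d :=
  \row_(i < d) 'D_(delta_mx 0 i) (f : 'rV[R]_d -> R^o) x.

Definition limiting_gradients (R : realType) (d : nat) (f : 'rV[R]_d -> R)
    (x : 'rV[R]_d) : set 'rV[R]_d :=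
  [set v | exists xs : nat -> 'rV[R]_d,
    [/\ forall n, differentiable (f : 'rV[R]_d -> R^o) (xs n),
        xs @ \oo --> x &
        cluster ((gradient f \o xs) @ \oo) v]].

Definition closed_convex_hull (R : realType) (d : nat) (S : set 'rV[R]_d) :
    set 'rV[R]_d :=
  smallest [set C : set 'rV[R]_d | closed C /\ convex_set C] S.

Definition clarke_subdifferential (R : realType) (d : nat)
    (f : 'rV[R]_d -> R) (x : 'rV[R]_d) : set 'rV[R]_d :=
  closed_convex_hull (limiting_gradients f x).

Definition wdc (R : realType) (d : nat) (A : set 'rV[R]_d) : Prop :=
  compact A /\
  exists (f : 'rV[R]_d -> R) (c : R),
    [/\ dc_function f,
        A = f @^-1` `]-oo, c] &
        exists2 eps : R, 0 < eps &
          forall x v, c < f x < c + eps ->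
            clarke_subdifferential f x v -> eps <= enorm v].

Definition locally_wdc (R : realType) (d : nat) (A : set 'rV[R]_d) : Prop :=
  forall x, A x ->
    exists U Ax : set 'rV[R]_d,
      [/\ open_nbhs x U, wdc Ax & A `&` U = Ax `&` U].

Definition dc_domain (R : realType) (d : nat) (M : set 'rV[R]_d) : Prop :=
  forall x, M x ->
    exists (U : set 'rV[R]_d) (E : {vspace 'rV[R]_d}) (e : 'rV[R]_d)
           (f : subvs_of E -> R),
      [/\ open_nbhs x U,
          (\dim E).+1 = d,
          e \in orthc E /\ enorm e = 1,
          dc_function f &
          M `&` U =
          [set y | exists u s, s <= f u /\ y = vsval u + s *: e] `&` U].

Definition dc_surface (R : realType) (d k : nat) (M : set 'rV[R]_d) : Prop :=
  forall x, M x ->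
    exists (U : set 'rV[R]_d) (L : {vspace 'rV[R]_d})
           (phi : subvs_of L -> subvs_of (orthc L)),
      [/\ open_nbhs x U,
          \dim L = k,
          dc_mapping phi &
          M `&` U = [set vsval u + vsval (phi u) | u in setT] `&` U].

(* Main.v *)
Require Import Defs.
From mathcomp Require Import all_boot all_order all_algebra.
From mathcomp Require Import all_classical all_reals all_analysis.
From mathcomp Require Import lra ring.

(* Let phi : L -> L^perp be a d.c. mapping, p the orthogonal projection onto L
   and z(y) = y - p y - phi(p y).  Near a given point x0, both a d.c. surface
   (r = 0) and, after lowering phi by a constant vector of length r, a d.c.
   domain (r large) coincide with the tube
   A = {y : |z(y)| <= r, |p(y - x0)| <= 1}, a sublevel set of the d.c. function
   h(y) = max(|z(y)| - r, |p(y - x0)| - 1).  As phi is K-Lipschitz on bounded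
   sets, at each x with 0 < h(x) < 1 the direction
   w = - p(x - x0) - B z(x)/|z(x)|, with B large compared with K, decreases at a
   uniform rate every term of the maximum that is active at x, at all points
   near x.  Hence all limiting gradients of h at x, and then all Clarke
   subgradients, lie in the half-space {v : <v, w> <= -1/2}, which stays away
   from the origin because w is bounded. *)

Set Implicit Arguments.
Unset Strict Implicit.
Unset Printing Implicit Defensive.

Import Order.TTheory GRing.Theory Num.Theory.
Import numFieldNormedType.Exports.

Local Open Scope classical_set_scope.
Local Open Scope ring_scope.

(** * Closure properties of convex and d.c. functions *)

Lemma convex_functionP (R : realType) (V : lmodType R) (g : V -> R) :
  convex_function setT g <->
  forall (t : R) (x y : V), 0 <= t <= 1 ->
    g (t *: x + (1 - t) *: y) <= t * g x + (1 - t) * g y.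
Proof.
split=> [cg t x y /andP[t0 t1]|cg t x y _ _]; last first.
  by apply: cg; rewrite ge0 le1.
have t01 : Itv.spec (@Itv.num_sem R) (Itv.Real `[0, 1]%Z) t.
  by rewrite /= /Itv.num_sem /= ger0_real // in_itv /= t0 t1.
by have := cg (Itv.mk t01) x y (in_setT _) (in_setT _).
Qed.

Section dc_closure.
Variables (R : realType) (V : lmodType R).
Implicit Types f g : V -> R.

Lemma convexD f g : convex_function setT f -> convex_function setT g ->
  convex_function setT (fun x => f x + g x).
Proof.
move=> /convex_functionP cf /convex_functionP cg; apply/convex_functionP.
by move=> t x y t01; have := cf t x y t01; have := cg t x y t01; lra.
Qed.

Lemma convexZ (a : R) f : 0 <= a -> convex_function setT f ->
  convex_function setT (fun x => a * f x).
Proof.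
move=> a0 /convex_functionP cf; apply/convex_functionP=> t x y t01.
by have := ler_wpM2l a0 (cf t x y t01); lra.
Qed.

Lemma convex_max f g : convex_function setT f -> convex_function setT g ->
  convex_function setT (fun x => Num.max (f x) (g x)).
Proof.
move=> /convex_functionP cf /convex_functionP cg; apply/convex_functionP.
move=> t x y /[dup] t01 /andP[t0 t1]; rewrite ge_max.
have t1' : 0 <= 1 - t by rewrite subr_ge0.
by apply/andP; split; [apply: le_trans (cf t x y t01) _
  |apply: le_trans (cg t x y t01) _]; apply: lerD;
  rewrite ler_wpM2l // le_max lexx ?orbT.
Qed.

Lemma convex_cst (a : R) : convex_function setT (fun _ : V => a).
Proof. by apply/convex_functionP => t x y _; lra. Qed.

Lemma dcD f g : dc_function f -> dc_function g ->
  dc_function (fun x => f x + g x).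
Proof.
move=> [f1 [f2 [cf1 cf2 fE]]] [g1 [g2 [cg1 cg2 gE]]].
exists (fun x => f1 x + g1 x), (fun x => f2 x + g2 x).
by split; [exact: convexD|exact: convexD|move=> x; rewrite fE gE; ring].
Qed.

Lemma dcN f : dc_function f -> dc_function (fun x => - f x).
Proof.
move=> [f1 [f2 [cf1 cf2 fE]]]; exists f2, f1.
by split => // x; rewrite fE; ring.
Qed.

Lemma dcZ (a : R) f : dc_function f -> dc_function (fun x => a * f x).
Proof.
wlog a0 : a f / 0 <= a => [dcZp|] dcf.
  have [/dcZp|/ltW a0] := leP 0 a; first by apply.
  have [||g [h [cg ch gE]]] := dcZp (- a) (fun x => - f x).
  - by rewrite oppr_ge0.
  - exact: dcN.
  by exists g, h; split => // x; rewrite -gE mulrNN.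
have [f1 [f2 [cf1 cf2 fE]]] := dcf.
exists (fun x => a * f1 x), (fun x => a * f2 x).
by split; [exact: convexZ|exact: convexZ|move=> x; rewrite fE; ring].
Qed.

Lemma dc_cst (a : R) : dc_function (fun _ : V => a).
Proof.
exists (fun=> a), (fun=> 0).
by split; [exact: convex_cst|exact: convex_cst|move=> ?; rewrite subr0].
Qed.

Lemma dc_max f g : dc_function f -> dc_function g ->
  dc_function (fun x => Num.max (f x) (g x)).
Proof.
move=> [f1 [f2 [cf1 cf2 fE]]] [g1 [g2 [cg1 cg2 gE]]].
(* Adding [f2 x + g2 x] to both arguments of the maximum makes each of them a sum of convex
   functions. *)
exists (fun x => Num.max (f1 x + g2 x) (g1 x + f2 x)), (fun x => f2 x + g2 x).
split; [|exact: convexD|] => [|x]; first by apply: convex_max; exact: convexD.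
by rewrite fE gE addr_maxl; congr Num.max; ring.
Qed.

Lemma dc_normr f : dc_function f -> dc_function (fun x => `|f x|).
Proof.
move=> dcf; have [g [h [cg ch gE]]] := dc_max dcf (dcN dcf).
by exists g, h; split => // x; rewrite -gE maxrN.
Qed.

Lemma dc_sum (I : Type) (s : seq I) (F : I -> V -> R) :
  (forall i, dc_function (F i)) -> dc_function (fun x => \sum_(i <- s) F i x).
Proof.
move=> dcF; elim: s => [|i s IHs].
  by under eq_fun do rewrite big_nil; exact: dc_cst.
by under eq_fun do rewrite big_cons; exact: dcD.
Qed.

Lemma dc_bigmax (I : Type) (s : seq I) (F : I -> V -> R) :
  (forall i, dc_function (F i)) ->
  dc_function (fun x => \big[Num.max/0]_(i <- s) F i x).
Proof.
move=> dcF; elim: s => [|i s IHs].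
  by under eq_fun do rewrite big_nil; exact: dc_cst.
by under eq_fun do rewrite big_cons; exact: dc_max.
Qed.

Lemma dc_linear (l : V -> R) : linear_for *%R l -> dc_function l.
Proof.
move=> lL; exists l, (fun=> 0).
split; [|exact: convex_cst|by move=> ?; rewrite subr0].
apply/convex_functionP => t x y _.
have l0 : l 0 = 0 by have := lL (-1) 0 0; rewrite scaler0 addr0 mulN1r addNr.
by rewrite lL -[_ *: y]addr0 lL l0 addr0.
Qed.

Lemma dc_comp (W : lmodType R) (l : {linear W -> V}) f :
  dc_function f -> dc_function (fun x => f (l x)).
Proof.
move=> [g [h [/convex_functionP cg /convex_functionP ch fE]]].
exists (fun x => g (l x)), (fun x => h (l x)).
by split => //; apply/convex_functionP => t x y t01;
  rewrite linearD !linearZ; [exact: cg|exact: ch].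
Qed.

End dc_closure.

Lemma dc_mx_norm (R : realType) (V : lmodType R) (d : nat)
    (F : V -> 'rV[R]_d) :
  (forall j, dc_function (fun x => F x 0 j)) -> dc_function (fun x => `|F x|).
Proof.
move=> dcF.
under eq_fun do rewrite [`|_|]mx_normrE.
by apply: dc_bigmax => -[i j] /=; rewrite ord1; exact: dc_normr.
Qed.

(** * Coordinates and neighbourhoods for the sup norm *)

Lemma normr_rVP (R : realType) (d : nat) (x : 'rV[R]_d) (r : R) : 0 <= r ->
  `|x| <= r <-> forall i, `|x 0 i| <= r.
Proof.
move=> r0; rewrite [`|x|]mx_normrE; split=> [xr i|xr].
  by apply: le_trans xr; apply/bigmax_geP; right; exists (0, i).
by apply: bigmax_le => // -[i j] _; rewrite ord1.
Qed.

Lemma normr_coord (R : realType) (d : nat) (x : 'rV[R]_d) i : `|x 0 i| <= `|x|.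
Proof. by move: i; apply/normr_rVP. Qed.

Lemma nbhs_rVP (R : realType) (d : nat) (x : 'rV[R]_d) (A : set 'rV[R]_d) :
  nbhs x A <-> exists2 e, 0 < e & forall y, `|x - y| < e -> A y.
Proof.
split=> [/(@nbhs_normP _ 'rV[R]_d)|] [e e0 eA]; first by exists e.
by apply/(@nbhs_normP _ 'rV[R]_d); exists e.
Qed.

(** * Lipschitz bounds on bounded sets *)

Section convex_lipschitz.
Variables (R : realType) (d : nat) (g : 'rV[R]_d -> R).
Hypothesis g_convex : convex_function setT g.

Let gP := (convex_functionP g).1 g_convex.

Lemma convex_midpoint x y : g (x + y) <= (g (2 *: x) + g (2 *: y)) / 2.
Proof.
have h01 : 0 <= (2^-1 : R) <= 1 by apply/andP; split; lra.
have := gP (2 *: x) (2 *: y) h01.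
have -> : 1 - 2^-1 = 2^-1 :> R by field.
by rewrite !scalerA mulVf // !scale1r; lra.
Qed.

(** A convex function on a segment is bounded by its values at the two endpoints. The degenerate
    case [r <= 0] forces [c = r = 0]. *)
Lemma convex_segment (e : 'rV[R]_d) (r c : R) : `|c| <= r ->
  g (c *: e) <= Num.max (g (r *: e)) (g (- r *: e)).
Proof.
rewrite ler_norml => /andP[rc cr].
have [r0|r0] := leP r 0.
  by have -> : c = r by [lra]; rewrite le_max lexx.
pose t := (c + r) / (2 * r).
have tE : 1 - t = (r - c) / (2 * r) by rewrite /t; field; lra.
have t0 : 0 <= t by apply: divr_ge0; lra.
have t1 : 0 <= 1 - t by rewrite tE; apply: divr_ge0; lra.
have /(gP (r *: e) (- r *: e)) : 0 <= t <= 1 by apply/andP; split; lra.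
rewrite !scalerA -scalerDl.
have -> : t * r + (1 - t) * - r = c by rewrite /t; field; lra.
move=> /le_trans; apply.
set m := Num.max _ _.
have m1 : g (r *: e) <= m by rewrite le_max lexx.
have m2 : g (- r *: e) <= m by rewrite le_max lexx orbT.
have := ler_wpM2l t0 m1; have := ler_wpM2l t1 m2; lra.
Qed.

(** Induction on the list of coordinates: [convex_midpoint] splits off one coordinate, which
    [convex_segment] controls. Each step doubles the radius, so [key] is stated for every [r]. *)
Lemma convex_bounded_above (r : R) : exists C, forall x, `|x| <= r -> g x <= C.
Proof.
have key (s : seq 'I_d) : forall r : R, exists C, forall c : 'I_d -> R,
    (forall i, `|c i| <= r) -> g (\sum_(i <- s) c i *: delta_mx 0 i) <= C.
  elim: s => [|j s IHs] {}r; first by exists (g 0) => c _; rewrite big_nil.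
  have [C gC] := IHs (2 * r).
  pose e : 'rV[R]_d := delta_mx 0 j.
  exists ((Num.max (g (2 * r *: e)) (g (- (2 * r) *: e)) + C) / 2) => c cr.
  have c2r i : `|2 * c i| <= 2 * r by rewrite normrM ger0_norm // ler_pM2l.
  rewrite big_cons; apply: le_trans (convex_midpoint _ _) _.
  rewrite ler_pM2r ?invr_gt0 //; apply: lerD.
    by rewrite scalerA; exact: convex_segment.
  rewrite scaler_sumr; under eq_bigr do rewrite scalerA.
  exact: (gC (fun i => 2 * c i)).
have [C gC] := key (index_enum 'I_d) r.
exists C => x xr; rewrite (row_sum_delta x); apply: gC => i.
exact: le_trans (normr_coord _ _) xr.
Qed.

(** Convexity at the midpoint 0 of [x] and [- x] turns the upper bound at [- x] into a lower bound
    at [x]. *)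
Lemma convex_bounded (r : R) : exists C, forall x, `|x| <= r -> `|g x| <= C.
Proof.
have [C gC] := convex_bounded_above r.
exists (`|C| + 2 * `|g 0|) => x xr.
have := gC x xr; have := gC (- x); rewrite normrN => /(_ xr) h1 h2.
have h01 : 0 <= (2^-1 : R) <= 1 by apply/andP; split; lra.
have := gP x (- x) h01.
have -> : 1 - 2^-1 = 2^-1 :> R by field.
rewrite scalerN subrr => h3.
have := ler_norm C; have := ler_norm (- C); rewrite normrN.
have := ler_norm (g 0); have := ler_norm (- g 0); rewrite normrN => *.
by rewrite ler_norml; apply/andP; split; lra.
Qed.

Lemma convex_lipschitz (r : R) :
  exists2 K, 0 <= K & forall x y, `|x| <= r -> `|y| <= r ->
    `|g x - g y| <= K * `|x - y|.
Proof.
have [C gC] := convex_bounded (r + 1).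
have C0 : 0 <= `|C| by [].
exists (2 * `|C|); first by lra.
suff main x y : `|x| <= r -> `|y| <= r ->
    g y - g x <= 2 * `|C| * `|x - y|.
  move=> x y xr yr; rewrite ler_norml; have := main _ _ xr yr.
  have := main _ _ yr xr; rewrite [`|y - x|]distrC => *.
  by apply/andP; split; lra.
move=> xr yr; have [->|xy] := eqVneq x y; first by rewrite !subrr normr0 mulr0.
set n := `|x - y|; have n0 : 0 < n by rewrite normr_gt0 subr_eq0.
(* [z] lies at distance 1 beyond [y] on the ray from [x], so [y] divides the segment from [x] to [z]
   in the ratio [t = n / (1 + n) <= n]. Convexity then gives [g y - g x <= t * (g z - g x)], and the
   last factor is at most [2 * |C|]. *)
pose z := y + n^-1 *: (y - x).
have zr : `|z| <= r + 1.
  apply: le_trans (ler_normD _ _) _; rewrite lerD // normrZ distrC -/n.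
  by rewrite ger0_norm ?invr_ge0 ?mulVf ?gt_eqF // ltW.
have gz := gC _ zr.
have gx : `|g x| <= C by apply: gC; apply: le_trans xr _; rewrite lerDl.
have CC := ler_norm C.
pose t := n / (1 + n).
have t0 : 0 <= t by apply: divr_ge0; lra.
have tn : t <= n by rewrite /t ler_pdivrMr; nra.
have t1 : t <= 1 by rewrite /t ler_pdivrMr; lra.
have /(gP z x) : 0 <= t <= 1 by rewrite t0 t1.
have -> : t *: z + (1 - t) *: x = y.
  apply/rowP => i; rewrite !mxE /t; field; lra.
move=> h.
have : t * (g z - g x) <= n * (2 * `|C|).
  apply: (@le_trans _ _ (t * (2 * `|C|))); last by rewrite ler_wpM2r //; lra.
  rewrite ler_wpM2l //; move: gz gx; rewrite !ler_norml.
  move=> /andP[_ +] /andP[+ _]; lra.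
lra.
Qed.

End convex_lipschitz.

Lemma dc_lipschitz (R : realType) (d : nat) (f : 'rV[R]_d -> R) (r : R) :
  dc_function f ->
  exists2 K, 0 <= K & forall x y, `|x| <= r -> `|y| <= r ->
    `|f x - f y| <= K * `|x - y|.
Proof.
move=> [g [h [cg ch fE]]].
have [K K0 gK] := convex_lipschitz cg r.
have [L L0 hL] := convex_lipschitz ch r.
exists (K + L) => [|x y xr yr]; first exact: addr_ge0.
have -> : f x - f y = (g x - g y) - (h x - h y) by rewrite !fE; ring.
by rewrite mulrDl; apply: le_trans (ler_normB _ _) _; rewrite lerD ?gK ?hL.
Qed.

Lemma dc_mapping_lipschitz (R : realType) (d m : nat)
    (F : 'rV[R]_d -> 'rV[R]_m) (r : R) :
  (forall j, dc_function (fun x => F x 0 j)) ->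
  exists2 K, 0 <= K & forall x y, `|x| <= r -> `|y| <= r ->
    `|F x - F y| <= K * `|x - y|.
Proof.
move=> dcF.
have /choice[K FK] j : exists K, 0 <= K /\ forall x y, `|x| <= r -> `|y| <= r ->
    `|F x 0 j - F y 0 j| <= K * `|x - y|.
  by have [K K0 FK] := dc_lipschitz r (dcF j); exists K.
have K0 j : 0 <= K j by case: (FK j).
exists (\sum_j K j) => [|x y xr yr]; first exact: sumr_ge0.
apply/normr_rVP => [|j]; first by rewrite mulr_ge0 // sumr_ge0.
rewrite !mxE; apply: le_trans ((FK j).2 _ _ xr yr) _.
by rewrite ler_wpM2r // (bigD1 j) //= lerDl sumr_ge0.
Qed.

Lemma dc_continuous (R : realType) (d : nat) (f : 'rV[R]_d -> R) :
  dc_function f -> continuous f.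
Proof.
move=> dcf x; have [K K0 fK] := dc_lipschitz (`|x| + 1) dcf.
apply/(@cvgrPdist_le _ _ _ (nbhs x) (nbhs_filter x)) => e e0; apply/nbhs_rVP.
(* The bound 1 keeps [y] in the ball on which [K] is valid; [K + 1] avoids a division by zero. *)
exists (Num.min 1 (e / (K + 1))) => [|y /=].
  by rewrite lt_min ltr01 divr_gt0 //; lra.
rewrite lt_min => /andP[/ltW yx1 /ltW yxe].
have yr : `|y| <= `|x| + 1.
  rewrite -[y](subrK x); apply: le_trans (ler_normD _ _) _.
  by rewrite addrC lerD2l distrC.
apply: (le_trans (fK x y _ yr)); first by rewrite lerDl.
apply: (@le_trans _ _ ((K + 1) * `|x - y|)).
  by rewrite ler_wpM2r // lerDl.
by rewrite mulrC -ler_pdivlMr //; lra.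
Qed.

(** * Clarke subgradients in a half-space *)

Section clarke_halfspace.
Variables (R : realType) (d : nat).
Implicit Types (f : 'rV[R]_d -> R) (x y v w : 'rV[R]_d).

Lemma gradient_dotv f y w : differentiable (f : 'rV[R]_d -> R^o) y ->
  'D_w (f : 'rV[R]_d -> R^o) y = dotv (gradient f y) w.
Proof.
move=> df; rewrite deriveE // {1}(row_sum_delta w) linear_sum.
by apply: eq_bigr => i _; rewrite linearZ mxE deriveE // mulrC.
Qed.

(** The right difference quotients of [f] along [w] are at most [- eta], and by differentiability
    they converge to the directional derivative. *)
Lemma gradient_dotv_le f y w (eta s : R) : 0 < s ->
    differentiable (f : 'rV[R]_d -> R^o) y ->
    (forall t, 0 < t < s -> f (y + t *: w) <= f y - eta * t) ->
  dotv (gradient f y) w <= - eta.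
Proof.
move=> s0 df fw; rewrite -gradient_dotv //.
have /cvg_dnbhs_at_right/cvgr_to_le : derivable (f : 'rV[R]_d -> R^o) y w.
  exact: diff_derivable.
apply; near=> t.
have t0 : 0 < t by near: t; exact: nbhs_right_gt.
have ts : t < s by near: t; exact: nbhs_right_lt.
have := fw t; rewrite t0 ts => /(_ isT) ft.
rewrite /= /shift /= [_ *: _]mulrC ler_pdivrMr // [t *: w + y]addrC; lra.
Unshelve. all: by end_near. Qed.

Lemma dotv_continuous w : continuous (fun v => dotv v w).
Proof. by apply: dc_continuous; apply: dc_linear; exact: dotv_linearl. Qed.

(** The half-space is closed and convex, so it suffices to treat limiting gradients. The decrease is
    assumed at all points near [x], hence it bounds the gradients at [xs n] for large [n], and the
    bound passes to cluster points. *)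
Lemma clarke_dotv_le f x w (eta s : R) : 0 < s ->
    (forall y t, `|x - y| < s -> 0 < t < s ->
      f (y + t *: w) <= f y - eta * t) ->
  forall v, clarke_subdifferential f x v -> dotv v w <= - eta.
Proof.
move=> s0 fw v; apply: (smallest_sub (X := [set v | dotv v w <= - eta])).
  split.
    apply: (@preimage_closed _ _ (fun v => dotv v w) [set a | a <= - eta]).
      by move=> u _; exact: dotv_continuous.
    exact: closed_le.
  move=> u1 u2 t; rewrite !inE /= => u1w u2w.
  rewrite dotv_linearl -[_ *: u2]addr0 dotv_linearl linear0l addr0.
  have t0 : 0 <= t%:num by exact: ge0.
  have t1 : 0 <= 1 - t%:num by rewrite subr_ge0; exact: le1.
  apply: (@le_trans _ _ (t%:num * - eta + (1 - t%:num) * - eta)); last by lra.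
  by apply: lerD; apply: ler_wpM2l.
move=> u [xs [df xsx cl]] /=; rewrite leNgt; apply/negP => uw.
have [z [/= zw]] :
    [set z | dotv z w <= - eta] `&` [set z | - eta < dotv z w] !=set0.
  apply: cl; last first.
    exact: (cvgr_gt (dotv u w) (@dotv_continuous w u)).
  have /nbhs_rVP xnear :
      exists2 e, 0 < e & forall y, `|x - y| < e -> `|x - y| < s.
    by exists s.
  have : \forall n \near \oo, `|x - xs n| < s by exact: xsx xnear.
  apply: filterS => n xn /=.
  by apply: (gradient_dotv_le s0) => // t ts; exact: fw.
by rewrite ltNge zw.
Qed.

End clarke_halfspace.

(** * Descent directions and the WDC condition *)

Lemma enorm_dotv_ge (R : realType) (d : nat) (v w : 'rV[R]_d) (eta W : R) :
  `|w| <= W -> dotv v w <= - eta -> eta <= enorm v * (d%:R * W + 1).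
Proof.
move=> wW vw; have v0 : 0 <= enorm v by exact: sqrtr_ge0.
have W0 : 0 <= W by exact: le_trans wW.
apply: (@le_trans _ _ (- dotv v w)); first by rewrite lerNr.
(* Each of the [d] products is at most [enorm v * W] in absolute value. The extra 1 keeps the factor
   positive for a later division. *)
apply: (@le_trans _ _ (enorm v * (d%:R * W))); last first.
  by rewrite ler_wpM2l // lerDl.
rewrite /dotv -sumrN.
have -> : enorm v * (d%:R * W) = \sum_(i < d) (enorm v * W).
  by rewrite sumr_const card_ord -mulr_natl; ring.
apply: ler_sum => i _; apply: le_trans (ler_norm _) _.
rewrite normrN normrM ler_pM //; last exact: le_trans (normr_coord _ _) wW.
rewrite /enorm -sqrtr_sqr ler_wsqrtr // /dotv expr2 (bigD1 i) //= lerDl.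
by apply: sumr_ge0 => j _; exact: sqr_ge0.
Qed.

(* A uniform decrease of [h] near [x] along [w], measured from the upper bound
   [m]: with [m] the maximum of [h] and other functions, this also covers the
   [h] that are inactive at [x]. *)
Definition descends (R : realType) (d : nat) (h m : 'rV[R]_d -> R)
    (x w : 'rV[R]_d) :=
  exists2 s : R, 0 < s & forall y t, `|x - y| < s -> 0 < t < s ->
    h (y + t *: w) <= m y - 2^-1 * t.

Section descends.
Variables (R : realType) (d : nat).
Implicit Types (h m : 'rV[R]_d -> R) (x w : 'rV[R]_d).

(** By continuity the gap between [h] and [m] at [x] persists nearby, and it absorbs [2^-1 * t] for
    small [t], whatever the direction [w]. *)
Lemma descends_lt h m x w : continuous h -> continuous m -> h x < m x ->
  descends h m x w.
Proof.
move=> ch cm hm; pose a := (m x - h x) / 4.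
have a0 : 0 < a by rewrite /a; lra.
have /nbhs_rVP[e e0 he] : \forall y \near x, h y < h x + a.
  by apply: (cvgr_lt (h x) (ch x)); lra.
have /nbhs_rVP[e' e'0 me] : \forall y \near x, m x - a < m y.
  by apply: (cvgr_gt (m x) (cm x)); lra.
have w0 : 0 < 2 * (`|w| + 1) by have := normr_ge0 w; lra.
exists (Num.min (Num.min (e / 2) e') (Num.min a (e / (2 * (`|w| + 1))))).
  by rewrite !lt_min e'0 a0 !divr_gt0.
move=> y t; rewrite !lt_min => /andP[/andP[xye xye'] _].
move=> /and3P[t0 _ /andP[ta]]; rewrite ltr_pdivlMr // => tw.
have := me _ xye'; have := he (y + t *: w) _; rewrite /a in ta *.
suff /[swap]/[apply] : `|x - (y + t *: w)| < e by lra.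
rewrite opprD addrA; apply: le_lt_trans (ler_normB _ _) _.
by rewrite normrZ gtr0_norm //; lra.
Qed.

Lemma descends_max h1 h2 m x w : descends h1 m x w -> descends h2 m x w ->
  descends (fun y => Num.max (h1 y) (h2 y)) m x w.
Proof.
move=> [s1 s10 h1m] [s2 s20 h2m]; exists (Num.min s1 s2).
  by rewrite lt_min s10.
move=> y t; rewrite !lt_min => /andP[xy1 xy2] /and3P[t0 t1 t2].
by rewrite ge_max h1m ?t0 // h2m ?t0.
Qed.

Lemma descends_le h m m' x w : (forall y, m y <= m' y) ->
  descends h m x w -> descends h m' x w.
Proof.
move=> mm [s s0 hm]; exists s => // y t xy ts.
by apply: le_trans (hm _ _ xy ts) _; rewrite lerB.
Qed.

Lemma wdc_descends h (W : R) : dc_function h ->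
    bounded_set (h @^-1` `]-oo, 0]) ->
    (forall x, 0 < h x < 1 -> exists2 w, `|w| <= W & descends h h x w) ->
  wdc (h @^-1` `]-oo, 0]).
Proof.
move=> dch bA hW; split.
  apply: bounded_closed_compact => //.
  apply: preimage_closed => [x _|]; first exact: dc_continuous.
  exact: closed_le.
pose W' := `|W|; pose c := 2 * (d%:R * W' + 1).
have c1 : 0 < c by rewrite mulr_gt0 // ltr_wpDl // mulr_ge0 // normr_ge0.
(* With rate 1/2, [enorm_dotv_ge] gives [c^-1 <= enorm v]; the bound 1 keeps [h x] in the range
   where a direction [w] is supplied. *)
exists h, 0; split => //; exists (Num.min 1 c^-1).
  by rewrite lt_min ltr01 invr_gt0.
move=> x v /andP[h0]; rewrite add0r lt_min => /andP[h1 _] xv.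
have /hW[w wW [s s0 hs]] : 0 < h x < 1 by rewrite h0.
have := clarke_dotv_le s0 hs xv.
move=> /(enorm_dotv_ge (le_trans wW (ler_norm _))) vge.
rewrite ge_min; apply/orP; right.
rewrite -[_^-1]mul1r ler_pdivrMr // /c; rewrite -/W' in vge; lra.
Qed.

End descends.

(** * Tubes around d.c. graphs are WDC *)

Section tube.
(** In the application [p] is the orthogonal projection onto [L] and [psi] is [phi] composed with
    it, so that all functions live on the whole space. *)
Variables (R : realType) (d : nat) (p : {linear 'rV[R]_d -> 'rV[R]_d}).
Variables (psi : 'rV[R]_d -> 'rV[R]_d) (x0 : 'rV[R]_d) (r : R).
Hypothesis pp : forall y, p (p y) = p y.
Hypothesis psip : forall y, psi (p y) = psi y.
Hypothesis ppsi : forall y, p (psi y) = 0.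
Hypothesis dc_psi : forall j, dc_function (fun y => psi y 0 j).
Hypothesis r_ge0 : 0 <= r.

Let z y := y - p y - psi y.
Let F y := `|z y| - r.
Let D y := `|p (y - x0)| - 1.
Let h y := Num.max (F y) (D y).

Let dc_p j : dc_function (fun y => p y 0 j).
Proof. by apply: dc_linear => a u v; rewrite linearP !mxE. Qed.

Let dc_z j : dc_function (fun y => z y 0 j).
Proof.
have -> : (fun y => z y 0 j) = (fun y => (y 0 j + - p y 0 j) + - psi y 0 j).
  by apply/funext => y; rewrite !mxE.
apply: dcD; last exact: dcN.
apply: dcD; last exact: dcN.
by apply: dc_linear => a u v; rewrite !mxE.
Qed.

Let dc_F : dc_function F.
Proof. by apply: dcD; [exact: dc_mx_norm|exact: dc_cst]. Qed.

Let dc_D : dc_function D.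
Proof.
apply: dcD; last exact: dc_cst.
apply: dc_mx_norm => j.
have -> : (fun y => p (y - x0) 0 j) = (fun y => p y 0 j + - p x0 0 j).
  by apply/funext => y; rewrite linearB !mxE.
by apply: dcD => //; exact: dc_cst.
Qed.

Let dc_h : dc_function h. Proof. exact: dc_max. Qed.

(** Radius of the ball on which [psi] must be Lipschitz: in [wdc_tube], [|p y| <= |p x0| + 3], and
    the displacement [t *: q] has norm at most 2. *)
Let rho := `|p x0| + 5.

Let p_near x (a : R) : 0 < a ->
  exists2 s, 0 < s & forall y, `|x - y| < s -> `|p (y - x)| <= a.
Proof.
move=> a0; have [K K0 pK] := dc_mapping_lipschitz 1 dc_p.
exists (Num.min 1 (a / (K + 1))).
  by rewrite lt_min ltr01 divr_gt0 //; lra.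
move=> y; rewrite distrC lt_min => /andP[/ltW y1].
rewrite ltr_pdivlMr; last by lra.
move=> /ltW ya; have := pK (y - x) 0 y1; rewrite normr0 linear0 !subr0.
move=> /(_ ler01) /le_trans; apply; have := normr_ge0 (y - x); lra.
Qed.

(** In [y = z y + p y + psi (p y)] the first two terms are bounded by definition of the tube, and
    the third because [psi] is Lipschitz on bounded sets. *)
Let bounded_tube : bounded_set (h @^-1` `]-oo, 0]).
Proof.
have [K K0 psiK] := dc_mapping_lipschitz rho dc_psi.
exists (r + rho + (K * rho + `|psi 0|)); split; first exact: num_real.
move=> M /ltW MM y; rewrite /= in_itv /= ge_max => /andP[Fy Dy].
apply: le_trans MM.
have rho0 : `|(0 : 'rV[R]_d)| <= rho by rewrite normr0 addr_ge0.
have yr : `|p y| <= rho.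
  have -> : p y = p (y - x0) + p x0 by rewrite linearB subrK.
  by apply: le_trans (ler_normD _ _) _; rewrite /D in Dy; rewrite /rho; lra.
have -> : y = z y + p y + (psi (p y) - psi 0 + psi 0).
  by rewrite /z psip; apply/rowP => j; rewrite !mxE; ring.
apply: le_trans (ler_normD _ _) _; apply: lerD.
  apply: le_trans (ler_normD _ _) _; apply: lerD => //.
  by rewrite /F in Fy; lra.
apply: le_trans (ler_normD _ _) _; apply: lerD => //.
apply: le_trans (psiK _ _ yr rho0) _; rewrite subr0.
by rewrite ler_wpM2l.
Qed.

Lemma wdc_tube :
  wdc [set y | `|y - p y - psi y| <= r /\ `|p (y - x0)| <= 1].
Proof.
have -> : [set y | `|y - p y - psi y| <= r /\ `|p (y - x0)| <= 1] =
    h @^-1` `]-oo, 0].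
  apply/seteqP; split => y /=; rewrite in_itv /= ge_max !subr_le0.
    by move=> [-> ->].
  by move=> /andP[].
have [K K0 psiK] := dc_mapping_lipschitz rho dc_psi.
(* Near [x], replacing [z x] by [z y] costs at most half of the decrease [t * B]; the other half,
   [t * (2 * K + 1)], exceeds the variation [2 * K * t] of [psi] by [t]. *)
pose B := 2 * (2 * K + 1); have B0 : 0 < B by rewrite /B; lra.
apply: (@wdc_descends _ _ _ (2 + B)) => // x.
rewrite lt_max gt_max => /andP[h0 /andP[_ D1]].
pose q := p (x - x0).
have q2 : `|q| <= 2 by move: D1; rewrite /D -/q; lra.
(* If [z x = 0], then [zeta = 0]. *)
pose zeta := `|z x|^-1 *: z x.
have pz y : p (z y) = 0 by rewrite /z !linearB pp ppsi subrr subr0.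
have pq : p q = q by rewrite /q pp.
have pzeta : p zeta = 0 by rewrite /zeta linearZ /= pz scaler0.
pose w := - q - B *: zeta.
have pw : p w = - q.
  by rewrite /w linearB linearN pq linearZ /= pzeta scaler0 subr0.
have pyw y t : p (y + t *: w) = p y - t *: q.
  by rewrite linearD linearZ /= pw scalerN.
exists w.
  apply: le_trans (ler_normB _ _) _; rewrite normrN lerD // normrZ.
  rewrite gtr0_norm // ler_piMr ?(ltW B0) // normrZ normfV normr_id.
  have [->|zx] := eqVneq (z x) 0; first by rewrite normr0 mulr0.
  by rewrite mulVf // normr_eq0.
(* When [D] is active, its rate of decrease is at least [|q| - 2 * |p (y - x)|] with [1 <= |q|], so
   the radius 1/4 leaves the rate 1/2. *)
have [s1 s10 ps1] := p_near x (a := 4^-1) ltac:(lra).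
apply: descends_max; last first.
  have [D0|D0] := ltP (D x) (h x).
    by apply: descends_lt => //; exact: dc_continuous.
  apply: (descends_le (m := D)) => [y|]; first by rewrite le_max lexx orbT.
  exists (Num.min 1 s1) => [|y t]; first by rewrite lt_min ltr01.
  rewrite !lt_min => /andP[_ /ps1 xy] /and3P[t0 t1 _].
  have q1 : 1 <= `|q|.
    move: D0; rewrite ge_max => /andP[]; rewrite -/(D x) => FD _.
    have : 0 < D x by case/orP: h0 => // /lt_le_trans; apply.
    by rewrite /D -/q; lra.
  rewrite /D.
  (* Since [p w = - q], the projection moves towards [p x0], up to the small error [p (y - x)]. *)
  have -> : p (y + t *: w - x0) = (1 - t) *: p (y - x0) + t *: p (y - x).
    rewrite linearB pyw /q !linearB.
    by apply/rowP => j; rewrite !mxE; ring.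
  have : `|q| <= `|p (y - x0)| + `|p (y - x)|.
    rewrite -[`|p (y - x)|]normrN; apply: le_trans (ler_normD _ _).
    by rewrite /q !linearB le_eqVlt; apply/orP; left; apply/eqP; congr `|_|;
       apply/rowP => j; rewrite !mxE; ring.
  have := ler_normD ((1 - t) *: p (y - x0)) (t *: p (y - x)).
  rewrite !normrZ !ger0_norm; [|lra..].
  have : t * `|p (y - x)| <= t * 4^-1 by rewrite ler_wpM2l // ltW.
  nra.
(* If [z x = 0], then [F x = - r <= 0 < h x], so [F] is inactive at [x]. Otherwise [F] itself
   decreases along [w], active or not. *)
have [z0|z0] := eqVneq (z x) 0.
  apply: descends_lt; [exact: dc_continuous|exact: dc_continuous|].
  rewrite lt_max; apply/orP; right; case/orP: h0.
    rewrite /F z0 normr0 sub0r oppr_gt0 => /lt_le_trans/(_ r_ge0).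
    by rewrite ltxx.
  by apply: le_lt_trans; rewrite /F z0 normr0 sub0r oppr_le0.
have zx0 : 0 < `|z x| by rewrite normr_gt0.
apply: (descends_le (m := F)) => [y|]; first by rewrite le_max lexx.
have /nbhs_rVP[s2 s20 zs2] : \forall y \near x, `|z y - z x| < `|z x| / 4.
  have dczx : dc_function (fun y => `|z y - z x|).
    apply: dc_mx_norm => j.
    have -> : (fun y => (z y - z x) 0 j) = (fun y => z y 0 j + - z x 0 j).
      by apply/funext => y; rewrite !mxE.
    by apply: dcD => //; exact: dc_cst.
  apply: (cvgr_lt `|z x - z x| (@dc_continuous _ _ _ dczx x)).
  by rewrite subrr normr0; lra.
exists (Num.min (Num.min 1 s1) (Num.min s2 (`|z x| / B))) => [|y t].
  by rewrite !lt_min ltr01 s10 s20 divr_gt0.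
rewrite !lt_min => /andP[/andP[_ /ps1 xy] /andP[/zs2 zyx _]].
move=> /and3P[t0 /andP[t1 _] /andP[_]]; rewrite ltr_pdivlMr // => tB.
have py : `|p y| <= `|p x0| + 3.
  have -> : p y = p (y - x) + q + p x0.
    by rewrite /q !linearB; apply/rowP => j; rewrite !mxE; ring.
  apply: le_trans (ler_normD _ _) _; rewrite addrC lerD2l.
  by apply: le_trans (ler_normD _ _) _; lra.
have pyr : `|p y| <= rho by rewrite /rho; lra.
have tq : `|t *: q| <= 2 * t by rewrite normrZ gtr0_norm // mulrC ler_pM2r.
have ptr : `|p y - t *: q| <= rho.
  by apply: le_trans (ler_normB _ _) _; rewrite /rho; lra.
have := psiK _ _ pyr ptr; rewrite subKr => dpsi.
(* With this [a], the step [t * B] along [zeta] is [a *: z x]. The bound on [t] gives [a <= 1], so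
   [1 - a] is a nonnegative factor of [z y] in [zE]. *)
pose a := t * B / `|z x|.
have a0 : 0 <= a by rewrite /a; apply: divr_ge0; [rewrite mulr_ge0 // ltW|].
have a1 : a <= 1 by rewrite /a ler_pdivrMr // mul1r ltW.
have zE : z (y + t *: w) =
    (1 - a) *: z y + a *: (z y - z x) + (psi (p y) - psi (p y - t *: q)).
  rewrite -pyw !psip /z pyw /w /zeta -/(z x) -/(z y) /a.
  apply/rowP => j; rewrite !mxE; field.
  by rewrite gt_eqF.
have az : a * `|z x| = t * B by rewrite /a divfK // gt_eqF.
clearbody a.
have zy : `|z x| <= `|z y| + `|z y - z x|.
  rewrite -[`|z y - z x|]normrN; apply: le_trans (ler_normD _ _).
  by rewrite opprB addrC subrK.
rewrite /F zE.
have := ler_normD ((1 - a) *: z y + a *: (z y - z x))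
  (psi (p y) - psi (p y - t *: q)).
have := ler_normD ((1 - a) *: z y) (a *: (z y - z x)).
have na : `|a| = a by rewrite ger0_norm.
have n1a : `|1 - a| = 1 - a by rewrite ger0_norm // subr_ge0.
rewrite !normrZ na n1a.
have : a * `|z y - z x| <= a * (`|z x| / 4) by rewrite ler_wpM2l // ltW.
have : a * `|z x| <= a * (`|z y| + `|z y - z x|) by rewrite ler_wpM2l.
have : K * `|t *: q| <= K * (2 * t) by rewrite ler_wpM2l.
move: az; rewrite /B; lra.
Qed.

Lemma open_cylinder : open [set y | `|p (y - x0)| < 1].
Proof.
have -> : [set y | `|p (y - x0)| < 1] = D @^-1` [set a | a < 0].
  by apply/seteqP; split=> y /=; rewrite subr_lt0.
by apply: open_comp => [y _|]; [exact: dc_continuous|exact: open_lt].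
Qed.

End tube.

(** * Orthogonal complements and projections *)

Section orthogonal_projection.
Variables (R : realType) (d : nat) (L : {vspace 'rV[R]_d}).

Lemma capv_orthc : (L :&: orthc L = 0)%VS.
Proof.
apply/eqP; rewrite -subv0; apply/subvP => u; rewrite memv_cap memv0.
move=> /andP[uL /mem_orthovP /(_ u uL) uu]; apply: contraT => /dotv_gt0.
by rewrite uu ltxx.
Qed.

Lemma dim_rV : \dim {: 'rV[R]_d} = d.
Proof. by rewrite dimvf /dim /= mul1n. Qed.

(** The complement is the intersection of the hyperplanes orthogonal to the vectors of a basis of
    [L], and each of them lowers the dimension by at most one. *)
Lemma dim_orthc_ge : (d <= \dim L + \dim (orthc L))%N.
Proof.
suff key n (u : 'I_n -> 'rV[R]_d) :
    (d <= n + \dim (\bigcap_(i < n) orthov (@dotv R d) <[u i]>))%N.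
  have := key (\dim L) (fun i => (vbasis L)`_i).
  by under eq_bigr do rewrite orthov1E.
elim: n u => [|n IHn] u; first by rewrite big_ord0 dim_rV.
rewrite big_ord_recr /=; set V := (\bigcap_(i < n) _)%VS.
have := leq_dim_orthov1 (@dotv R d) (u ord_max) V.
have := IHn (fun i => u (widen_ord (leqnSn n) i)).
rewrite -/V; set a := \dim V; set b := \dim _ => h1 h2.
apply: leq_trans h1 _; rewrite addSnnS leq_add2l.
by apply: leq_trans (leqSpred a) _.
Qed.

Lemma addv_orthc : (L + orthc L = fullv)%VS.
Proof.
apply/eqP; rewrite eqEdim subvf /= dim_rV.
by have := dimv_sum_cap L (orthc L); rewrite capv_orthc dimv0 addn0 => ->;
   exact: dim_orthc_ge.
Qed.

Definition orthproj : 'End('rV[R]_d) := daddv_pi L (orthc L).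

Lemma orthproj_mem y : orthproj y \in L.
Proof. exact: memv_pi. Qed.

Lemma orthproj_id y : y \in L -> orthproj y = y.
Proof. by move=> yL; rewrite daddv_pi_id ?capv_orthc. Qed.

Lemma orthproj_compl y : y - orthproj y \in orthc L.
Proof.
have yE : orthproj y + daddv_pi (orthc L) L y = y.
  by rewrite daddv_pi_add ?capv_orthc // addv_orthc memvf.
by rewrite -[X in X - _]yE addrAC subrr add0r memv_pi.
Qed.

Lemma orthproj0 y : y \in orthc L -> orthproj y = 0.
Proof.
move=> yL; have : orthproj y \in (L :&: orthc L)%VS.
  rewrite memv_cap orthproj_mem -[orthproj y](subKr y) rpredB //.
  exact: orthproj_compl.
by rewrite capv_orthc memv0 => /eqP.
Qed.

End orthogonal_projection.

(** * Tubes around graphs over a subspace *)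

Section graph_tube.
Variables (R : realType) (d : nat) (L : {vspace 'rV[R]_d}).

Definition subproj (y : 'rV[R]_d) : subvs_of L := vsproj L (orthproj L y).

Lemma vsval_subproj y : vsval (subproj y) = orthproj L y.
Proof. by rewrite vsprojK // orthproj_mem. Qed.

Lemma dc_subproj (f : subvs_of L -> R) : dc_function f ->
  dc_function (fun y => f (subproj y)).
Proof. exact: (@dc_comp _ _ _ (vsproj L \o orthproj L)). Qed.

Variable phi : subvs_of L -> subvs_of (orthc L).
Hypothesis dc_phi : dc_mapping phi.

(** [dc_mapping] concerns coordinates in a basis of [orthc L]; the entries of the vector in the
    ambient space are fixed linear combinations of them. *)
Lemma dc_graph j : dc_function (fun y => vsval (phi (subproj y)) 0 j).
Proof.
pose b := vbasis {: subvs_of (orthc L)}.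
have -> : (fun y => vsval (phi (subproj y)) 0 j) =
    (fun y => \sum_(i < \dim {: subvs_of (orthc L)})
      vsval b`_i 0 j * coord b i (phi (subproj y))).
  apply/funext => y; rewrite {1}(coord_vbasis (memvf (phi (subproj y)))).
  rewrite linear_sum summxE; apply: eq_bigr => i _.
  by rewrite linearZ mxE mulrC.
apply: dc_sum => i; apply: dcZ; exact: (dc_subproj (dc_phi i)).
Qed.

Lemma wdc_graph_tube (x0 : 'rV[R]_d) (r : R) : 0 <= r ->
  wdc [set y | `|y - orthproj L y - vsval (phi (subproj y))| <= r /\
               `|orthproj L (y - x0)| <= 1].
Proof.
move=> r0; have pp y : orthproj L (orthproj L y) = orthproj L y.
  by rewrite orthproj_id ?orthproj_mem.
apply: (wdc_tube (psi := fun y => vsval (phi (subproj y)))) => //.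
- by move=> y; rewrite /subproj pp.
- by move=> y; apply: orthproj0; rewrite subvsP.
- exact: dc_graph.
Qed.

End graph_tube.

(** * D.c. surfaces and d.c. domains *)

Lemma locally_wdc_surface (R : realType) (d k : nat) (M : set 'rV[R]_d) :
  dc_surface k M -> locally_wdc M.
Proof.
move=> surfM x /surfM[U [L [phi [[openU Ux] _ dc_phi MU]]]].
(* In the open cylinder the second condition of the tube is automatic, and with radius 0 the first
   one says that [y] is on the graph. *)
exists (U `&` [set y | `|orthproj L (y - x)| < 1]).
exists [set y | `|y - orthproj L y - vsval (phi (subproj L y))| <= 0 /\
               `|orthproj L (y - x)| <= 1].
split; last 1 first.
- rewrite !setIA MU; apply/seteqP; split => y /= [[]].
    move=> [u _ <-] Uy y1; split => //; split => //; split; last exact: ltW.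
    set v := vsval u + _.
    have pv : orthproj L v = vsval u.
      by rewrite linearD /= orthproj_id ?subvsP // orthproj0 ?subvsP // addr0.
    by rewrite /subproj pv vsvalK /v addrAC addrK subrr normr0.
  move=> [+ _] Uy y1; rewrite normr_le0 subr_eq0 => /eqP yE.
  split => //; split => //; exists (subproj L y) => //.
  by rewrite vsval_subproj -yE addrC subrK.
- split; first by apply: openI => //; exact: open_cylinder.
  by split => //=; rewrite subrr linear0 normr0.
- exact: wdc_graph_tube.
Qed.

Lemma locally_wdc_domain (R : realType) (d : nat) (M : set 'rV[R]_d) :
  dc_domain M -> locally_wdc M.
Proof.
move=> domM x Mx.
have [U [E [e [f [[openU Ux] dimE [eE e1] dcf MU]]]]] := domM x Mx.
have ee : dotv e e = 1.
  rewrite -[LHS]sqr_sqrtr -/(enorm e) ?e1 ?expr1n // sumr_ge0 // => i _.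
  exact: sqr_ge0.
have e0 : e != 0.
  apply/eqP => e0; move: ee; rewrite e0 linear0r => /eqP.
  by rewrite eq_sym oner_eq0.
have eE0 v : v \in E -> dotv v e = 0.
  by move=> vE; rewrite dotvC; move/mem_orthovP: eE; exact.
(* As [E] has codimension 1, its orthogonal complement is the line spanned by [e]. *)
have yE y : y = orthproj E y + dotv y e *: e.
  have /vlineP[c yc] : y - orthproj E y \in <[e]>%VS.
    suff -> : <[e]>%VS = orthc E by exact: orthproj_compl.
    apply/eqP; rewrite eqEdim -memvE eE dim_vline e0 /=.
    have := dimv_sum_cap E (orthc E).
    rewrite capv_orthc dimv0 addn0 addv_orthc dim_rV.
    by rewrite -[X in X = _]dimE -addn1 => /addnI <-.
  have -> : dotv y e = c; last by rewrite -yc addrC subrK.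
  rewrite -[y](subrK (orthproj E y)) yc dotv_linearl ee mulr1.
  by rewrite eE0 ?orthproj_mem // addr0.
(* The tube around the graph of [f - r] has the graph of [f] as upper face and that of [f - 2 * r]
   as lower face. This [r] puts [x] strictly above the lower face. *)
pose r := `|f (subproj E x) - dotv x e| + 1.
have r0 : 0 <= r by rewrite addr_ge0.
pose phi (u : subvs_of E) := (f u - r) *: Subvs eE.
have dc_phi : dc_mapping phi.
  move=> i; set b := vbasis _.
  have -> : (fun u => coord b i (phi u)) =
      (fun u => coord b i (Subvs eE) * (f u + - r)).
    by apply/funext => u; rewrite linearZ /= mulrC.
  by apply: dcZ; apply: dcD => //; exact: dc_cst.
pose lower y := f (subproj E y) + - dotv y e - 2 * r.
have dc_lower : dc_function lower.
  apply: dcD; last exact: dc_cst.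
  apply: dcD; first exact: dc_subproj.
  by apply: dcN; apply: dc_linear; exact: dotv_linearl.
(* The radius carries the factor [|e|] because this is the sup norm of [e]; only the Euclidean norm
   is 1. *)
have tubeE y : `|y - orthproj E y - vsval (phi (subproj E y))| <= r * `|e| <->
    dotv y e <= f (subproj E y) /\ lower y <= 0.
  have -> : y - orthproj E y - vsval (phi (subproj E y)) =
      (dotv y e - (f (subproj E y) - r)) *: e.
    rewrite {1}[y]yE [_ - orthproj E y]addrAC subrr add0r.
    by rewrite scalerBl linearZ.
  rewrite normrZ ler_pM2r ?normr_gt0 // ler_norml /lower.
  by split=> [/andP[]|[]] *; [split|apply/andP; split]; lra.
(* The condition [lower y < 0] keeps the neighbourhood off the lower face, so that only the upper
   face, the graph of [f], bounds the tube there. *)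
exists (U `&` ([set y | `|orthproj E (y - x)| < 1] `&` [set y | lower y < 0])).
exists [set y | `|y - orthproj E y - vsval (phi (subproj E y))| <= r * `|e| /\
               `|orthproj E (y - x)| <= 1].
split; last 1 first.
- rewrite !setIA MU; apply/seteqP; split => y /= [[[]]].
    move=> [u [s [sf ->]]] Uy y1 ylow; do !split => //; last exact: ltW.
    apply/tubeE; split; last exact: ltW.
    have -> : subproj E (vsval u + s *: e) = u.
      rewrite /subproj linearD /= orthproj_id ?subvsP // orthproj0 ?rpredZ //.
      by rewrite addr0 vsvalK.
    by rewrite addrC dotv_linearl ee mulr1 eE0 ?subvsP // addr0.
  move=> [/tubeE[yf _] _] Uy y1 ylow; do !split => //.
  by exists (subproj E y), (dotv y e); rewrite vsval_subproj -yE.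
- split.
    apply: openI => //; apply: openI; first exact: open_cylinder.
    apply: (@open_comp _ _ lower [set a | a < 0]); last exact: open_lt.
    by move=> y _; exact: dc_continuous.
  split => //; split => /=; first by rewrite subrr linear0 normr0.
  rewrite /lower /r; have := ler_norm (f (subproj E x) - dotv x e).
  have := normr_ge0 (f (subproj E x) - dotv x e); lra.
- by apply: wdc_graph_tube => //; rewrite mulr_ge0.
Qed.

Theorem proposition3p3 (R : realType) (d : nat) :
  (forall M : set 'rV[R]_d, dc_domain M -> locally_wdc M) /\
  (forall (k : nat) (M : set 'rV[R]_d), dc_surface k M -> locally_wdc M).
Proof.
split=> [M|k M]; [exact: locally_wdc_domain|exact: locally_wdc_surface].
Qed.
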